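(* Let $\Omega\subset\mathbb R^d$ be a bounded Borel set, $f:\Omega\to[0,\infty)$ bounded with $\int_\Omega f=1$, $p\ge1$, $x_1,x_2\in\Omega$, and $h_1,h_2:[0,1]\to[0,\infty)$ non-decreasing and Lipschitz continuous. For $\rho\in(0,1)$ and any Borel $\psi_0:\Omega\to[0,1]$, define recursively for $j\ge0$: $m_j=\int_\Omega(1-\psi_j)f\,dx$, $t_{j+1}=h_2(1-m_j)-h_1(m_j)$, and $$\psi_{j+1}(x)=\begin{cases}\rho\,\psi_j(x)&\text{if }\tau(x)<t_{j+1},\\ 1-\rho(1-\psi_j(x))&\text{otherwise.}\end{cases}$$ Then there exists $\bar\rho\in(0,1)$ (depending only on $\Omega,f,p,x_1,x_2,h_1,h_2$) such that, for every $\rho\in(\bar\rho,1)$ and every $\psi_0$, $\psi_j\to\bar\psi$ uniformly on every compact subset of $\Omega\setminus\{\tau=\bar t\}$.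
   Context: $\tau(x)=|x-x_1|^p-|x-x_2|^p$, $m(t)=\int_{\{x\in\Omega:\tau(x)<t\}}f\,dx$, $G(t)=h_2(1-m(t))-h_1(m(t))$. There is a unique $\bar t\in\mathbb R$ with $G(\bar t)=\bar t$, and $\bar\psi(x)=0$ if $\tau(x)<\bar t$, $\bar\psi(x)=1$ if $\tau(x)>\bar t$ (this encodes the unique equilibrium $A_1=\{\tau<\bar t\}$, $A_2=\{\tau>\bar t\}$). $\psi_j(x)\in[0,1]$ is the fraction of citizens at $x$ going to $x_2$ on day $j$. *)

(* Defs.v *)
From HB Require Import structures.
From mathcomp Require Import all_boot all_order all_algebra.
From mathcomp Require Import all_classical all_reals all_analysis.
Set Implicit Arguments. Unset Strict Implicit. Unset Printing Implicit Defensive.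
Import Order.TTheory GRing.Theory Num.Theory.
Import numFieldNormedType.Exports.
Local Open Scope classical_set_scope.
Local Open Scope ring_scope.

Definition Rd (R : realType) (d : nat) := g_sigma_algebraType (@open 'rV[R]_d).

Definition box (R : realType) (d : nat) (a b : 'rV[R]_d) : set 'rV[R]_d :=
  [set x | forall i : 'I_d, a 0 i <= x 0 i <= b 0 i].

(* lam is the d-dimensional Lebesgue measure on the Borel sets of R^d:
   it gives every box its volume (this determines it uniquely). *)
Definition is_lebesgue (R : realType) (d : nat)
  (lam : {measure set (Rd R d) -> \bar R}) : Prop :=
  forall a b : 'rV[R]_d, (forall i, a 0 i <= b 0 i) ->
    lam (box a b : set (Rd R d)) = (\prod_(i < d) (b 0 i - a 0 i))%:E.

Definition edist (R : realType) (d : nat) (x y : 'rV[R]_d) : R :=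
  Num.sqrt (\sum_(i < d) (x 0 i - y 0 i) ^+ 2).

Definition tau (R : realType) (d : nat) (p : R) (x1 x2 x : 'rV[R]_d) : R :=
  (edist x x1) `^ p - (edist x x2) `^ p.

Definition mfun (R : realType) (d : nat) (lam : {measure set (Rd R d) -> \bar R})
  (Om : set 'rV[R]_d) (f : 'rV[R]_d -> R) (p : R) (x1 x2 : 'rV[R]_d) (t : R) : R :=
  fine (\int[lam]_(x in (Om `&` [set y | tau p x1 x2 y < t] : set (Rd R d))) (f x)%:E).

Definition Gfun (R : realType) (d : nat) (lam : {measure set (Rd R d) -> \bar R})
  (Om : set 'rV[R]_d) (f : 'rV[R]_d -> R) (p : R) (x1 x2 : 'rV[R]_d)
  (h1 h2 : R -> R) (t : R) : R :=
  h2 (1 - mfun lam Om f p x1 x2 t) - h1 (mfun lam Om f p x1 x2 t).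

(* psibar: 0 on {tau < tbar}, 1 on {tau > tbar} (value on {tau = tbar}
   is irrelevant for the theorem and set to 1). *)
Definition psibar (R : realType) (d : nat) (p : R) (x1 x2 : 'rV[R]_d) (tbar : R)
  (x : 'rV[R]_d) : R :=
  if tau p x1 x2 x < tbar then 0 else 1.

Fixpoint psi (R : realType) (d : nat) (lam : {measure set (Rd R d) -> \bar R})
  (Om : set 'rV[R]_d) (f : 'rV[R]_d -> R) (p : R) (x1 x2 : 'rV[R]_d)
  (h1 h2 : R -> R) (rho : R) (psi0 : 'rV[R]_d -> R) (j : nat) : 'rV[R]_d -> R :=
  match j with
  | 0 => psi0
  | j'.+1 =>
    let pj := psi lam Om f p x1 x2 h1 h2 rho psi0 j' in
    let m := fine (\int[lam]_(x in (Om : set (Rd R d))) ((1 - pj x) * f x)%:E) in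
    let t := h2 (1 - m) - h1 m in
    fun x => if tau p x1 x2 x < t then rho * pj x else 1 - rho * (1 - pj x)
  end.

(* Main.v *)
Require Import Defs.
From HB Require Import structures.
From mathcomp Require Import all_boot all_order all_algebra.
From mathcomp Require Import all_classical all_reals all_analysis.
From mathcomp Require Import measurable_realfun lra ring.
Import Order.TTheory GRing.Theory Num.Theory.
Import numFieldNormedType.Exports.
Local Open Scope classical_set_scope.
Local Open Scope ring_scope.
Set Implicit Arguments.
Unset Strict Implicit.
Unset Printing Implicit Defensive.

(* The fraction m_j of citizens going to x1 obeys the scalar relaxation
   m_(j+1) = rho m_j + (1 - rho) m (g (m_j)), with g s = h2 (1 - s) - h1 s
   non-increasing and Lipschitz, and m tbar is a fixed point of m o g. A Lipschitz
   bound on m on one side of tbar makes one side of the fixed point invariant for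
   rho close to 1, so m_j converges to m tbar and the thresholds converge to tbar;
   away from {tau = tbar} the recursion for psi_j is then eventually a contraction
   towards psibar.

   The Lipschitz bound on m comes from the convexity of |.|^p: tau grows at a linear
   rate in the direction x2 - x1, so translates of a thin band {t <= tau < tbar} in
   this direction are disjoint, and translation invariance of the Lebesgue measure
   bounds its volume. The rate degenerates only for p = 1 and |tbar| = |x1 - x2|;
   there m is constant on one side of tbar, or d = 1 and the band is an interval. *)

Lemma geometric_small (R : realType) (rho B eps : R) : 0 < rho < 1 -> 0 <= B ->
  0 < eps -> exists N : nat, forall k, (N <= k)%N -> rho ^+ k * B < eps.
Proof.
move=> /andP[rho0 rho1] B0 eps0.
have /cvgrPdist_lt/(_ (eps / (B + 1))) : (rho ^+ k @[k --> \oo] --> 0).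
  by apply: cvg_expr; rewrite gtr0_norm.
have B1 : 0 < B + 1 by lra.
rewrite divr_gt0// => /(_ isT) [N _ HN]; exists N => k Nk.
have := HN k Nk; rewrite /= sub0r normrN gtr0_norm ?exprn_gt0// ltr_pdivlMr//.
apply: le_lt_trans; rewrite ler_wpM2l ?exprn_ge0//; lra.
Qed.

Lemma contraction_small (R : realType) (rho : R) (e : nat -> R) (j0 : nat) :
  0 < rho < 1 -> (forall j, (j0 <= j)%N -> `|e j.+1| <= rho * `|e j|) ->
  forall eps, 0 < eps -> exists N, forall j, (N <= j)%N -> `|e j| < eps.
Proof.
move=> rho01 He eps eps0.
have [rho0 rho1] := andP rho01.
have H k : `|e (j0 + k)%N| <= rho ^+ k * `|e j0|.
  elim: k => [|k IH]; first by rewrite addn0 expr0 mul1r.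
  rewrite addnS (le_trans (He _ (leq_addr _ _)))// exprS -mulrA ler_wpM2l//.
  exact: ltW.
have [N HN] := geometric_small rho01 (normr_ge0 (e j0)) eps0.
exists (j0 + N)%N => j jN; rewrite -(subnKC (leq_trans (leq_addr N j0) jN)).
by rewrite (le_lt_trans (H _))// HN// leq_subRL// (leq_trans (leq_addr N j0) jN).
Qed.

(* The Lipschitz bound on the nonnegative side makes that side invariant once
   rho is close to 1, so the error changes sign at most once. *)
Lemma relaxation_cvg (R : realType) (rho C : R) (e F : nat -> R) :
  0 < rho < 1 -> (1 - rho) * C <= rho ->
  (forall j, e j.+1 = rho * e j + (1 - rho) * F j) ->
  (forall j, 0 <= e j -> - (C * e j) <= F j <= 0) ->
  (forall j, e j <= 0 -> 0 <= F j) ->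
  forall eps, 0 < eps -> exists N, forall j, (N <= j)%N -> `|e j| < eps.
Proof.
move=> rho01 rhoC eS Fpos Fneg.
have [rho0 rho1] := andP rho01.
have stay j : 0 <= e j -> 0 <= e j.+1 <= rho * e j.
  move=> ej; have /andP[F1 F2] := Fpos _ ej; rewrite eS; apply/andP; split; nra.
have [[j0 ej0]|/forallNP neg] := pselect (exists j0, 0 <= e j0).
  have ge0 k : 0 <= e (j0 + k)%N.
    elim: k => [|k IH]; first by rewrite addn0.
    by rewrite addnS; have /andP[] := stay _ IH.
  apply: (@contraction_small _ rho _ j0) => // j jj0.
  have ej : 0 <= e j by rewrite -(subnKC jj0).
  have /andP[? ?] := stay _ ej; by rewrite !ger0_norm.
apply: (@contraction_small _ rho _ 0) => // j _.
have {}neg k : e k < 0 by rewrite ltNge; apply/negP/neg.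
have F0 := Fneg _ (ltW (neg j)); have := neg j.+1; rewrite !ltr0_norm// eS => ?.
nra.
Qed.

Lemma powR_tangent_lt (R : realType) (p a m : R) : 1 < p -> 0 <= a -> 0 < m ->
  a != m -> m `^ p + p * m `^ p * (a / m - 1) < a `^ p.
Proof.
move=> p1 a0 m0 am.
have mp0 : 0 < m `^ p by rewrite powR_gt0.
move: a0; rewrite le_eqVlt => /orP[/eqP <-|a0].
  rewrite powR0; last by rewrite gt_eqF//; lra.
  by rewrite mul0r; nra.
have am0 : 0 < a / m by rewrite divr_gt0.
set z := ln (a / m).
have az : a / m = expR z by rewrite lnK.
have z0 : z != 0.
  rewrite ln_eq0//; apply: contra am => /eqP am1.
  by rewrite -(divfK (lt0r_neq0 m0) a) am1 mul1r.
have -> : a `^ p = m `^ p * expR (p * z).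
  rewrite -{1}(divfK (lt0r_neq0 m0) a) mulrC powRM ?ltW//; congr (_ * _).
  by rewrite /powR gt_eqF.
rewrite az -[X in X + _]mulr1 -mulrA [X in _ + X]mulrCA -mulrDr ltr_pM2l//.
have -> : p * z = (p - 1) * z + z by ring.
have e1 : 1 + (p - 1) * z < expR ((p - 1) * z).
  by rewrite expR_gt1Dx// mulf_neq0//; lra.
have e2 : 1 + - z < expR (- z) by rewrite expR_gt1Dx// oppr_eq0.
rewrite expRD; have Ez := expR_gt0 z.
have EE : expR z * expR (- z) = 1 by rewrite expRN mulfV// gt_eqF.
move: e1 e2 EE Ez; set E1 := expR _; set E2 := expR (- z); set E := expR z.
move=> e1 e2 EE Ez; have : E * ((p - 1) * (E2 - (1 - z)) + (E1 - (1 + (p - 1) * z))) > 0.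
  rewrite mulr_gt0// addr_gt0// ?subr_gt0// mulr_gt0 ?subr_gt0//.
suff -> : E * ((p - 1) * (E2 - (1 - z)) + (E1 - (1 + (p - 1) * z))) =
  (p - 1) * (E * E2) + E1 * E - p * E by rewrite EE; lra.
by ring.
Qed.

Lemma powR_tangent_le (R : realType) (p a m : R) : 1 <= p -> 0 <= a -> 0 < m ->
  m `^ p + p * m `^ p * (a / m - 1) <= a `^ p.
Proof.
move=> p1 a0 m0; have [->|am] := eqVneq a m.
  by rewrite divff ?gt_eqF// subrr mulr0 addr0.
move: p1; rewrite le_eqVlt => /orP[/eqP <-|p1]; last exact/ltW/powR_tangent_lt.
rewrite !powRr1// ?(ltW m0)//.
rewrite mul1r mulrBr mulr1 [m * _]mulrC (divfK (lt0r_neq0 m0)).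
by rewrite addrC subrK.
Qed.

Lemma powR_convex (R : realType) (p a b k : R) : 1 <= p -> 0 <= a -> 0 <= b ->
  0 <= k <= 1 -> (k * a + (1 - k) * b) `^ p <= k * a `^ p + (1 - k) * b `^ p.
Proof.
move=> p1 a0 b0 /andP[k0 k1]; set m := k * a + _.
have : 0 <= m by rewrite addr_ge0// mulr_ge0//; lra.
rewrite le_eqVlt => /orP[/eqP <-|m0].
  rewrite powR0; last by rewrite gt_eqF//; lra.
  by rewrite addr_ge0// mulr_ge0 ?powR_ge0//; lra.
have ta := powR_tangent_le p1 a0 m0; have tb := powR_tangent_le p1 b0 m0.
have mE : k * (a / m - 1) + (1 - k) * (b / m - 1) = 0.
  have : m / m = 1 by rewrite divff ?gt_eqF.
  by rewrite {1}/m mulrDl -!mulrA => ?; lra.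
have : k * (m `^ p + p * m `^ p * (a / m - 1)) +
  (1 - k) * (m `^ p + p * m `^ p * (b / m - 1)) <= k * a `^ p + (1 - k) * b `^ p.
  by rewrite lerD// ler_wpM2l//; lra.
suff -> : k * (m `^ p + p * m `^ p * (a / m - 1)) +
  (1 - k) * (m `^ p + p * m `^ p * (b / m - 1)) =
  m `^ p + p * m `^ p * (k * (a / m - 1) + (1 - k) * (b / m - 1)).
  by rewrite mE mulr0 addr0.
by ring.
Qed.

Lemma powR_midpoint_lt (R : realType) (p a b : R) : 1 < p -> 0 <= a -> 0 <= b ->
  a != b -> ((a + b) / 2) `^ p < (a `^ p + b `^ p) / 2.
Proof.
move=> p1 a0 b0 ab; set m := (a + b) / 2.
have m0 : 0 < m.
  rewrite /m; move: a0 b0 ab; rewrite !le_eqVlt.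
  move=> /orP[/eqP <-|?] /orP[/eqP <-|?]; rewrite ?eqxx//; lra.
have am : a != m by apply: contra ab => /eqP; rewrite /m => ?; apply/eqP; lra.
have ta := powR_tangent_lt p1 a0 m0 am; have tb := powR_tangent_le (ltW p1) b0 m0.
have mE : (a / m - 1) + (b / m - 1) = 0.
  have : m / m = 1 by rewrite divff ?gt_eqF.
  by rewrite {1}/m mulrAC mulrDl => ?; lra.
have : (m `^ p + p * m `^ p * (a / m - 1)) + (m `^ p + p * m `^ p * (b / m - 1)) <
   a `^ p + b `^ p by rewrite ltr_leD.
suff -> : (m `^ p + p * m `^ p * (a / m - 1)) + (m `^ p + p * m `^ p * (b / m - 1)) =
  2 * m `^ p + p * m `^ p * ((a / m - 1) + (b / m - 1)).
  by rewrite mE mulr0 addr0; lra.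
by ring.
Qed.

Lemma continuous_normr_powR (R : realType) (p : R) : 1 <= p ->
  continuous (fun y : R => `|y| `^ p).
Proof.
move=> p1 y; have [->|y0] := eqVneq y 0.
  rewrite /continuous_at normr0 powR0; last by rewrite gt_eqF//; lra.
  apply/cvgrPdist_lt => e e0; near=> x.
  rewrite sub0r normrN ger0_norm ?powR_ge0//.
  have xe : `|x| < Num.min e 1.
    near: x; apply: (@cvgr0_norm_lt _ _ _ _ _ id); first exact: cvg_id.
    by rewrite lt_min e0 ltr01.
  have [->|x0] := eqVneq x 0.
    by rewrite normr0 powR0// gt_eqF//; lra.
  move: xe; rewrite lt_min => /andP[xe x1].
  by rewrite (le_lt_trans _ xe)// ge1r_powR// normr_gt0 x0 ltW.
apply: (@continuous_comp R R R (fun z : R => `|z|) (fun z : R => z `^ p)).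
  exact: norm_continuous.
apply: differentiable_continuous; apply/derivable1_diffP.
have y0' : 0 < `|y| by rewrite normr_gt0.
by have [] := is_derive1_powR p y0'.
Unshelve. all: by end_near. Qed.

Section Euclidean.
Variables (R : realType) (d : nat).
Implicit Types a b u v x y : 'rV[R]_d.

Definition dot a b : R := \sum_(i < d) a 0 i * b 0 i.

Definition enorm a : R := Num.sqrt (dot a a).

Lemma dotC a b : dot a b = dot b a.
Proof. by apply: eq_bigr => i _; rewrite mulrC. Qed.

Lemma dotDl a b c : dot (a + b) c = dot a c + dot b c.
Proof. by rewrite /dot -big_split/=; apply: eq_bigr => i _; rewrite mxE mulrDl. Qed.

Lemma dotZl k a b : dot (k *: a) b = k * dot a b.
Proof. by rewrite /dot mulr_sumr; apply: eq_bigr => i _; rewrite mxE mulrA. Qed.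

Lemma dotDr a b c : dot a (b + c) = dot a b + dot a c.
Proof. by rewrite dotC dotDl !(dotC a). Qed.

Lemma dotZr k a b : dot a (k *: b) = k * dot a b.
Proof. by rewrite dotC dotZl dotC. Qed.

Lemma dot_ge0 a : 0 <= dot a a.
Proof. by apply: sumr_ge0 => i _; rewrite -expr2 sqr_ge0. Qed.

Lemma dot_eq0 a : (dot a a == 0) = (a == 0).
Proof.
apply/idP/eqP => [|->]; last by rewrite /dot big1// => i _; rewrite mxE mul0r.
rewrite /dot psumr_eq0; last by move=> i _; rewrite -expr2 sqr_ge0.
move=> /allP H; apply/rowP => i; rewrite mxE; apply/eqP.
by have := H i (mem_index_enum i); rewrite /= mulf_eq0 orbb.
Qed.

Lemma enorm_ge0 a : 0 <= enorm a.
Proof. exact: sqrtr_ge0. Qed.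

Lemma enorm_sqr a : enorm a ^+ 2 = dot a a.
Proof. by rewrite sqr_sqrtr// dot_ge0. Qed.

Lemma enorm_eq0 a : (enorm a == 0) = (a == 0).
Proof. by rewrite -dot_eq0 -enorm_sqr sqrf_eq0. Qed.

Lemma edistE x y : Defs.edist x y = enorm (x - y).
Proof.
by congr (Num.sqrt _); apply: eq_bigr => i _; rewrite !mxE expr2.
Qed.

Lemma cauchy_gap a b : dot (dot b b *: a + - dot a b *: b) (dot b b *: a + - dot a b *: b) =
  dot b b * (dot a a * dot b b - dot a b ^+ 2).
Proof.
rewrite !(dotDl, dotDr, dotZl, dotZr) (dotC b a); ring.
Qed.

Lemma cauchy_schwarz a b : dot a b ^+ 2 <= dot a a * dot b b.
Proof.
have [->|b0] := eqVneq b 0.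
  by rewrite -(scale0r (0 : 'rV[R]_d)) !dotZr !mul0r mulr0 expr0n.
have B0 : 0 < dot b b by rewrite lt_def dot_eq0 b0 dot_ge0.
by have := dot_ge0 (dot b b *: a + - dot a b *: b);
  rewrite cauchy_gap pmulr_rge0// subr_ge0.
Qed.

Lemma dot_le_enorm a b : dot a b <= enorm a * enorm b.
Proof.
rewrite (le_trans (ler_norm _))// -(@ler_pXn2r _ 2)// ?nnegrE//.
  by rewrite real_normK ?num_real// exprMn !enorm_sqr cauchy_schwarz.
by rewrite mulr_ge0// enorm_ge0.
Qed.

Lemma enormD_sqr a b : enorm (a + b) ^+ 2 =
  enorm a ^+ 2 + 2 * dot a b + enorm b ^+ 2.
Proof. rewrite !enorm_sqr !(dotDl, dotDr) (dotC b a); ring. Qed.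

Lemma enormZ k a : enorm (k *: a) = `|k| * enorm a.
Proof.
by rewrite /enorm dotZl dotZr mulrA -expr2 sqrtrM ?sqr_ge0// sqrtr_sqr.
Qed.

Lemma enormN a : enorm (- a) = enorm a.
Proof. by rewrite -scaleN1r enormZ normrN1 mul1r. Qed.

Lemma enormD_le a b : enorm (a + b) <= enorm a + enorm b.
Proof.
rewrite -(@ler_pXn2r _ 2)// ?nnegrE ?addr_ge0 ?enorm_ge0//.
by rewrite enormD_sqr; have := dot_le_enorm a b; lra.
Qed.

Lemma enormD_eq_dot a b : enorm (a + b) = enorm a + enorm b ->
  dot a b = enorm a * enorm b.
Proof. by move=> E; have := enormD_sqr a b; rewrite E; lra. Qed.

Lemma enormD_eq_sub a b : enorm (a + b) = enorm a + enorm b ->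
  enorm (a - b) = `|enorm a - enorm b|.
Proof.
move=> /enormD_eq_dot E; apply/eqP.
rewrite -(@eqrXn2 _ 2)// ?enorm_ge0// real_normK ?num_real// enormD_sqr enormN.
by apply/eqP; rewrite -scaleN1r dotZr E; lra.
Qed.

Lemma enormD_eq_parallel a b (i j : 'I_d) : enorm (a + b) = enorm a + enorm b ->
  a 0 i * b 0 j = a 0 j * b 0 i.
Proof.
move=> /enormD_eq_dot E; have [->|b0] := eqVneq b 0; first by rewrite !mxE !mulr0.
have : dot b b * (dot a a * dot b b - dot a b ^+ 2) = 0.
  by rewrite E -!enorm_sqr; ring.
rewrite -cauchy_gap => /eqP; rewrite dot_eq0 => /eqP/rowP H.
have Bb : dot b b != 0 by rewrite dot_eq0.
have := H i; have := H j; rewrite !mxE => Hj Hi; apply: (mulfI Bb).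
have -> : dot b b * (a 0 i * b 0 j) = (dot b b * a 0 i) * b 0 j by ring.
have -> : dot b b * (a 0 j * b 0 i) = (dot b b * a 0 j) * b 0 i by ring.
have -> : dot b b * a 0 i = dot a b * b 0 i by lra.
have -> : dot b b * a 0 j = dot a b * b 0 j by lra.
by ring.
Qed.

Lemma enorm_powR_convex p a b k : 1 <= p -> 0 <= k <= 1 ->
  enorm (k *: a + (1 - k) *: b) `^ p <= k * enorm a `^ p + (1 - k) * enorm b `^ p.
Proof.
move=> p1 k01; rewrite (le_trans _ (powR_convex p1 (enorm_ge0 _) (enorm_ge0 _) k01))//.
have /andP[k0 k1] := k01.
have q0 : 0 <= 1 - k by lra.
apply: ge0_ler_powR; rewrite ?nnegrE ?enorm_ge0//; first by lra.
  by rewrite addr_ge0// mulr_ge0// enorm_ge0.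
by rewrite (le_trans (enormD_le _ _))// !enormZ !ger0_norm.
Qed.

Definition midgap p a b : R :=
  enorm a `^ p + enorm b `^ p - 2 * enorm (2^-1 *: (a + b)) `^ p.

Lemma midgap_gt0 p a b : 1 <= p -> a != b ->
  (p = 1 -> `|enorm a - enorm b| != enorm (a - b)) -> 0 < midgap p a b.
Proof.
move=> p1 ab H; have p0 : 0 < p by lra.
have E : enorm (2^-1 *: (a + b)) = enorm (a + b) / 2.
  by rewrite enormZ ger0_norm ?invr_ge0// mulrC.
have tri := enormD_le a b.
have a0 := enorm_ge0 a; have b0 := enorm_ge0 b; have c0 := enorm_ge0 (a + b).
rewrite /midgap E subr_gt0 mulrC -ltr_pdivlMr//.
have [Eab|Nab] := eqVneq (enorm (a + b)) (enorm a + enorm b).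
  rewrite Eab; apply: powR_midpoint_lt => //.
    move: p1; rewrite le_eqVlt => /orP[/eqP p1|//].
    by have := H (esym p1); rewrite (enormD_eq_sub Eab) eqxx.
  apply: contra ab => /eqP ab; have := enormD_eq_sub Eab.
  by rewrite ab subrr normr0 => /eqP; rewrite enorm_eq0 subr_eq0.
have lt : enorm (a + b) < enorm a + enorm b by rewrite lt_neqAle Nab.
apply: (@lt_le_trans _ _ (((enorm a + enorm b) / 2) `^ p)).
  by apply: gt0_ltr_powR; rewrite ?nnegrE//; lra.
have := @powR_convex _ p (enorm a) (enorm b) 2^-1 p1 a0 b0.
have -> : 1 - 2^-1 = 2^-1 :> R by lra.
rewrite -!mulrDr !(mulrC 2^-1); apply.
by rewrite invr_ge0 ler0n/= invf_le1// ler1n.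
Qed.

End Euclidean.

Lemma tauE (R : realType) (d : nat) (p : R) (x1 x2 x : 'rV[R]_d) :
  tau p x1 x2 x = enorm (x - x1) `^ p - enorm (x - x2) `^ p.
Proof. by rewrite /tau !edistE. Qed.

(* Along the line x + s u the function phi = |.|^p is convex; compare its slopes
   on [1, 1 + s] and [1/2, 1], and on [0, s] and [0, 1/2]. *)
Lemma tau_shift (R : realType) (d : nat) (p s : R) (x1 x2 x : 'rV[R]_d) :
  1 <= p -> 0 <= s <= 2^-1 ->
  tau p x1 x2 x + 2 * s * midgap p (x - x1) (x - x2) <=
  tau p x1 x2 (x + s *: (x2 - x1)).
Proof.
move=> p1 /andP[s0 s1]; rewrite !tauE /midgap.
set a := x - x1; set b := x - x2; set h := 2^-1 *: (a + b).
have uE : x2 - x1 = a - b by rewrite /a /b; apply/rowP => i; rewrite !mxE; lra.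
have -> : x + s *: (x2 - x1) - x1 = a + s *: (a - b) by rewrite uE /a addrAC.
have -> : x + s *: (x2 - x1) - x2 = b + s *: (a - b) by rewrite uE /b addrAC.
clear uE; clearbody a b; have s21 : 0 < 1 + 2 * s by lra.
have Es : b + s *: (a - b) = (2 * s) *: h + (1 - 2 * s) *: b.
  by apply/rowP => i; rewrite !mxE; lra.
have Ea : a = (1 - (1 + 2 * s)^-1) *: h + (1 - (1 - (1 + 2 * s)^-1)) *: (a + s *: (a - b)).
  apply/rowP => i; rewrite !mxE; have := mulfV (lt0r_neq0 s21).
  set k := (1 + 2 * s)^-1 => kE.
  apply: (mulfI (lt0r_neq0 s21)); rewrite mulrDr !mulrA.
  have -> : (1 + 2 * s) * (1 - k) = 2 * s by rewrite mulrBr kE; lra.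
  have -> : (1 + 2 * s) * (1 - (1 - k)) = 1 by rewrite subKr kE.
  by lra.
have k01 : 0 <= 1 - (1 + 2 * s)^-1 <= 1.
  rewrite subr_ge0 gerBl invr_ge0 (ltW s21) andbT invf_le1//; lra.
have C2 := @enorm_powR_convex _ _ p h b (2 * s) p1.
have C1 := enorm_powR_convex h (a + s *: (a - b)) p1 k01.
rewrite -Ea in C1; rewrite -Es in C2.
have {}C2 : enorm (b + s *: (a - b)) `^ p <=
  2 * s * enorm h `^ p + (1 - 2 * s) * enorm b `^ p by apply: C2; apply/andP; lra.
have {}C1 : (1 + 2 * s) * enorm a `^ p <=
  2 * s * enorm h `^ p + enorm (a + s *: (a - b)) `^ p.
  have := mulfV (lt0r_neq0 s21); move: C1; set k := (1 + 2 * s)^-1 => C1 kE.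
  have := ler_wpM2l (ltW s21) C1; rewrite mulrDr !mulrA.
  have -> : (1 + 2 * s) * (1 - k) = 2 * s by rewrite mulrBr kE; lra.
  have -> : (1 + 2 * s) * (1 - (1 - k)) = 1 by rewrite subKr kE.
  by rewrite mul1r.
by lra.
Qed.

(* Filter inference does not see the topology of 'rV through its nbhs structure. *)
Lemma nbhs_filter_rV (R : realType) (d : nat) (x : 'rV[R]_d) : Filter (nbhs x).
Proof. exact: (@nbhs_filter ('rV[R]_d : topologicalType)). Qed.

Section Continuity.
Variables (R : realType) (d : nat).


Lemma continuous_enorm : continuous (@enorm R d).
Proof.
move=> x; have FF := nbhs_filter_rV x.
apply: (@continuous_comp _ _ _ (fun x : 'rV[R]_d => dot x x) Num.sqrt).
  have H (l : seq 'I_d) : (fun y : 'rV[R]_d => \sum_(i <- l) y 0 i * y 0 i) @ x -->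
      \sum_(i <- l) x 0 i * x 0 i.
    elim: l => [|i l IH].
      have -> : (fun y : 'rV[R]_d => \sum_(i <- [::]) y 0 i * y 0 i) = fun=> 0.
        by apply/funext => y; rewrite big_nil.
      rewrite big_nil; exact: cvg_cst.
    have -> : (fun y : 'rV[R]_d => \sum_(i <- i :: l) y 0 i * y 0 i) =
        fun y => y 0 i * y 0 i + \sum_(i <- l) y 0 i * y 0 i.
      by apply/funext => y; rewrite big_cons.
    rewrite big_cons; apply: cvgD => //; apply: cvgM; exact: coord_continuous.
  exact: H.
exact: sqrt_continuous.
Qed.

Lemma continuous_enorm_powR p : 1 <= p -> continuous (fun x : 'rV[R]_d => enorm x `^ p).
Proof.
move=> p1 x; have FF := nbhs_filter_rV x.
have -> : (fun x : 'rV[R]_d => enorm x `^ p) = (fun y => `|y| `^ p) \o (@enorm R d).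
  by apply/funext => y /=; rewrite ger0_norm ?enorm_ge0.
by apply: continuous_comp; [exact: continuous_enorm|exact: continuous_normr_powR].
Qed.

Lemma continuous_shift_enorm_powR p (c : 'rV[R]_d) : 1 <= p ->
  continuous (fun x : 'rV[R]_d => enorm (x - c) `^ p).
Proof.
move=> p1 x; have FF := nbhs_filter_rV x; 
apply: (@continuous_comp 'rV[R]_d 'rV[R]_d R (fun x => x - c) (fun x => enorm x `^ p)).
  by apply: cvgB; [exact: cvg_id|exact: cvg_cst].
exact: continuous_enorm_powR.
Qed.

Lemma continuous_tau p (x1 x2 : 'rV[R]_d) : 1 <= p -> continuous (tau p x1 x2).
Proof.
move=> p1 x; have FF := nbhs_filter_rV x; rewrite (_ : tau p x1 x2 = fun y =>
  enorm (y - x1) `^ p - enorm (y - x2) `^ p); last by apply/funext => y; rewrite tauE.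
by apply: cvgB; exact: continuous_shift_enorm_powR.
Qed.

Lemma continuous_midgap p (x1 x2 : 'rV[R]_d) : 1 <= p ->
  continuous (fun x : 'rV[R]_d => midgap p (x - x1) (x - x2)).
Proof.
move=> p1 x; have FF := nbhs_filter_rV x.
have -> : (fun x : 'rV[R]_d => midgap p (x - x1) (x - x2)) = fun x : 'rV[R]_d =>
   enorm (x - x1) `^ p + enorm (x - x2) `^ p - 2 * enorm (x - 2^-1 *: (x1 + x2)) `^ p.
  apply/funext => y; rewrite /midgap; congr (_ - _ * enorm _ `^ _).
  by apply/rowP => i; rewrite !mxE; lra.
apply: cvgB; first by apply: cvgD; exact: continuous_shift_enorm_powR.
by apply: cvgM; [exact: cvg_cst|exact: continuous_shift_enorm_powR].
Qed.

End Continuity.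

Section LebesgueRd.
Variables (R : realType) (d : nat).
Local Notation V := 'rV[R]_d.
Local Notation T := (Rd R d).

Definition boxes : set (set T) := [set A | exists a b : V, A = box a b].

Lemma box_closed (a b : V) : closed (box a b).
Proof.
have -> : box a b = \bigcap_(i in [set: 'I_d])
    ((fun x : V => x 0 i) @^-1` `[a 0 i, b 0 i]%classic).
  apply/seteqP; split => [x bx i _|x bx i]; first by rewrite /= in_itv; exact: bx.
  by have := bx i I; rewrite /= in_itv.
apply: closed_bigI => i _; apply: preimage_closed; last exact: interval_closed.
by move=> x _; exact: coord_continuous.
Qed.

Lemma open_measurable_Rd (U : set V) : open U -> measurable (U : set T).
Proof. by move=> oU; exact: sub_sigma_algebra. Qed.

Lemma closed_measurable_Rd (U : set V) : closed U -> measurable (U : set T).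
Proof.
by move=> cU; rewrite -(setCK U); apply: measurableC; apply: open_measurable_Rd; exact: closed_openC.
Qed.

Lemma box_measurable (a b : V) : measurable (box a b : set T).
Proof. by apply: closed_measurable_Rd; exact: box_closed. Qed.

Lemma open_ratbox (U : set V) (x : V) : open U -> U x ->
  exists q : 'rV[rat]_d * 'rV[rat]_d,
    let B := box (map_mx ratr q.1) (map_mx ratr q.2) in B x /\ B `<=` U.
Proof.
move=> oU Ux; have /nbhs_ballP[e /= e0 eU] : nbhs x U by exact: open_nbhs_nbhs.
have HP i : exists q : rat * rat,
    x 0 i - e < ratr q.1 < x 0 i /\ x 0 i < ratr q.2 < x 0 i + e.
  have /rat_in_itvoo[q1 q1P] : x 0 i - e < x 0 i by rewrite gtrBl.
  have /rat_in_itvoo[q2 q2P] : x 0 i < x 0 i + e by rewrite ltrDl.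
  by exists (q1, q2); move: q1P q2P; rewrite !in_itv.
have [q qP] := fin_all_exists HP.
exists (\row_i (q i).1, \row_i (q i).2); split => [i|y By].
  by rewrite !mxE; have [/andP[_ /ltW->] /andP[/ltW->]] := qP i.
apply: eU; split => // i j; rewrite ord1; have := By j; rewrite !mxE.
have [/andP[? ?] /andP[? ?] /andP[? ?]] := qP j.
by rewrite /ball/= ltr_norml; apply/andP; split; lra.
Qed.

Lemma measurable_RdE : @measurable _ T = <<s boxes >>.
Proof.
apply/seteqP; split; last first.
  apply: smallest_sub; first exact: sigma_algebra_measurable.
  by move=> _ [a [b ->]]; exact: box_measurable.
apply: smallest_sub; first exact: smallest_sigma_algebra.
move=> U oU.
have -> : U = \bigcup_(q : 'rV[rat]_d * 'rV[rat]_d)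
    (if `[<box (map_mx ratr q.1) (map_mx ratr q.2) `<=` U>] then
      box (map_mx ratr q.1) (map_mx ratr q.2) else set0).
  apply/seteqP; split => [x Ux|x [q _]]; last by case: asboolP => // H; exact: H.
  have [q [Bx BU]] := open_ratbox oU Ux.
  by exists q => //; case: asboolP.
apply: (@countable_bigcupT_measurable _ (g_sigma_algebraType boxes)) => // q.
by case: asboolP => // _; apply: sub_sigma_algebra; do 2 eexists.
Qed.

Lemma boxes_setI_closed : setI_closed boxes.
Proof.
move=> _ _ [a [b ->]] [a' [b' ->]].
exists (\row_i Num.max (a 0 i) (a' 0 i)), (\row_i Num.min (b 0 i) (b' 0 i)).
apply/seteqP; split => x.
  by move=> [h h'] i; rewrite !mxE ge_max le_min; have /andP[-> ->] := h i; exact: h'.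
move=> h; split => i; have := h i; rewrite !mxE ge_max le_min => /andP[/andP[? ?]/andP[? ?]];
  by apply/andP.
Qed.

Definition cube (M : R) : set V := box (const_mx (- M)) (const_mx M).

Lemma cubeP (M : R) (x : V) : cube M x <-> forall i, `|x 0 i| <= M.
Proof.
by split => [h i|h i]; have := h i; rewrite !mxE ler_norml.
Qed.

Lemma cube_bigcup : \bigcup_n cube n%:R = [set: V].
Proof.
apply/seteqP; split => // x _.
exists (Num.truncn (\sum_i `|x 0 i|)).+1 => //; apply/cubeP => i.
rewrite (le_trans _ (ltW (truncnS_gt _)))// (bigD1 i)//= lerDl.
exact: sumr_ge0.
Qed.

Lemma cube_compact (M : R) : compact (cube M).
Proof.
have -> : cube M = [set v : V | forall i, `[- M, M]%classic (v ord0 i)].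
  by apply/seteqP; split => x h i; have := h i; rewrite /= in_itv/= !mxE.
by apply: (@rV_compact _ _ (fun=> `[- M, M]%classic)) => _; exact: segment_compact.
Qed.

Lemma bounded_sub_cube (A : set V) : bounded_set A -> exists2 M, 0 < M & A `<=` cube M.
Proof.
move=> [M [Mreal normA]]; exists (`|M| + 1) => [|x Ax].
  by rewrite ltr_wpDl.
apply/cubeP => i.
have M1 : M < `|M| + 1 by rewrite (le_lt_trans (ler_norm M))// ltrDl.
rewrite (le_trans _ (normA _ M1 _ Ax))//.
by rewrite [leRHS]/Num.norm /= mx_normrE; apply/bigmax_geP; right => /=; exists (0, i).
Qed.

Lemma continuous_measurable_Rd (f : V -> R) : continuous f ->
  measurable_fun setT (f : T -> R).
Proof.
move=> /continuousP cf; apply: (measurability _ (RGenOpens.measurableE R)).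
move=> _ [_ [a [b ->] <-]]; rewrite setTI; apply: open_measurable_Rd.
exact/cf/interval_open.
Qed.

Lemma addr_measurable_Rd (v : V) : measurable_fun setT ((fun x : V => x + v) : T -> T).
Proof.
apply: (@measurability _ _ T T setT _ (@open V)) => // _ [U oU <-]; rewrite setTI.
apply: open_measurable_Rd; apply: open_comp => // x _.
have FF := nbhs_filter_rV x; apply: cvgD; [exact: cvg_id|exact: cvg_cst].
Qed.

Lemma translate_measurable (A : set V) (v : V) : measurable (A : set T) ->
  measurable ([set x | A (x + v)] : set T).
Proof.
by move=> mA; rewrite -[X in measurable X]setTI; exact: addr_measurable_Rd.
Qed.

Variable lam : {measure set T -> \bar R}.
Hypothesis Hlam : is_lebesgue lam.

Lemma box_fin (a b : V) : (lam (box a b) < +oo)%E.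
Proof.
have [ab|/existsNP[i /negP]] := pselect (forall i, a 0 i <= b 0 i).
  by rewrite Hlam// ltry.
rewrite -ltNge => ba; rewrite (_ : box a b = set0) ?measure0 ?ltry//.
apply/seteqP; split => // x /(_ i) /andP[h h']; have := le_trans h h'.
by rewrite leNgt ba.
Qed.

Lemma lebesgue_translate (A : set V) (v : V) : measurable (A : set T) ->
  lam [set x | A (x + v)] = lam A.
Proof.
move=> mA; pose mu : {measure set T -> \bar R} :=
  measure_function_pushforward__canonical__measure_function_Measure lam (addr_measurable_Rd v).
suff : lam A = mu A by [].
apply: (@measure_unique _ _ _ boxes (fun n => cube n%:R)) => //.
- exact: measurable_RdE.
- exact: boxes_setI_closed.
- by move=> i; do 2 eexists.
- exact: cube_bigcup.
- move=> _ [a [b ->]]; rewrite /mu/= /pushforward.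
  have -> : (fun x : V => x + v) @^-1` box a b = box (a - v) (b - v).
    by apply/seteqP; split => x h i; have := h i; rewrite !mxE lerBlDr lerBrDr.
  have [ab|/existsNP[i /negP]] := pselect (forall i, a 0 i <= b 0 i).
    rewrite !Hlam//; last by move=> i; rewrite !mxE lerD2r.
    by congr (_%:E); apply: eq_bigr => i _; rewrite !mxE; ring.
  rewrite -ltNge => ba.
  have E (a' b' : V) : b' 0 i < a' 0 i -> box a' b' = set0.
    move=> ba'; apply/seteqP; split => // x /(_ i) /andP[h h'].
    by have := le_trans h h'; rewrite leNgt ba'.
  by rewrite !E// !mxE ltrD2r.
- by move=> k; exact: box_fin.
Qed.

Lemma disjoint_translates (A B : set V) (v : V) (N : nat) :
  measurable (A : set T) -> measurable (B : set T) -> (lam B < +oo)%E ->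
  A `<=` B ->
  (forall k x, (k < N)%N -> A x -> B (x + k%:R *: v)) ->
  (forall k x, (0 < k < N)%N -> A x -> ~ A (x + k%:R *: v)) ->
  N%:R * fine (lam A) <= fine (lam B).
Proof.
move=> mA mB Boo AB sub dis.
pose F k : set T := [set x : V | A (x + - (k%:R *: v))].
have mF k : measurable (F k) by exact: translate_measurable.
have finA : lam A \is a fin_num.
  rewrite ge0_fin_numE// (le_lt_trans _ Boo)//; apply: le_measure => //; exact/mem_set.
have lamF k : lam (F k) = (fine (lam A))%:E.
  by rewrite fineK// lebesgue_translate.
have FB : \bigcup_(k in `I_N) F k `<=` B.
  by move=> x [k kN Fk]; have := sub k _ kN Fk; rewrite subrK.
have tF : trivIset `I_N F.
  have lt_dis k l x : (k < l)%N -> (l < N)%N -> F k x -> F l x -> False.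
    move=> kl lN Fk Fl; apply: (dis (l - k)%N _ _ Fl).
      by rewrite subn_gt0 kl (leq_ltn_trans (leq_subr _ _)).
    rewrite natrB ?(ltnW kl)// scalerBl addrA subrK; exact: Fk.
  move=> k l /= kN lN [x [Fk Fl]]; case: (ltngtP k l) => // h; exfalso.
    exact: lt_dis h lN Fk Fl.
  exact: lt_dis h kN Fl Fk.
have : (lam (\bigcup_(k in `I_N) F k) <= lam B)%E.
  apply: le_measure => //; apply/mem_set => //.
  by apply: fin_bigcup_measurable.
rewrite measure_fin_bigcup// -fsbig_ord; rewrite (eq_bigr (fun=> (fine (lam A))%:E)); last by move=> i _; exact: lamF.
rewrite sumEFin sumr_const card_ord -{1}(@fineK _ (lam B)) ?ge0_fin_numE//.
by rewrite lee_fin mulr_natl.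
Qed.

End LebesgueRd.

Lemma compact_pos_min (R : realType) (d : nat) (K : set 'rV[R]_d) (g : 'rV[R]_d -> R) : compact K ->
  continuous g -> (forall x, K x -> 0 < g x) ->
  exists2 c, 0 < c & forall x, K x -> c <= g x.
Proof.
move=> cK cg g0; have [K0|/set0P/negP/negPn/eqP->] := pselect (K !=set0); last by exists 1.
have [c cK' cmin] := EVT_min_rV K0 cK (continuous_subspaceT cg).
exists (g c); first by apply: g0; exact: set_mem.
by move=> x Kx; apply: cmin; exact: mem_set.
Qed.

Lemma exists_other_index n (i : 'I_n) : (1 < n)%N -> exists j : 'I_n, j != i.
Proof.
case: n i => [|[|n]] i // _; exists (lift i ord0); by rewrite eq_sym neq_lift.
Qed.

Section Bands.
Variables (R : realType) (d : nat) (lam : {measure set (Rd R d) -> \bar R}).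
Hypothesis Hlam : is_lebesgue lam.
Variables (Om : set 'rV[R]_d) (p : R) (x1 x2 : 'rV[R]_d).
Hypothesis HOm_meas : measurable (Om : set (Rd R d)).
Hypothesis HOm_bdd : bounded_set Om.
Hypothesis Hp : 1 <= p.

Definition band (s t : R) : set 'rV[R]_d :=
  Om `&` [set x | s <= tau p x1 x2 x < t].

Lemma measurable_tau : measurable_fun setT (tau p x1 x2 : Rd R d -> R).
Proof. by apply: continuous_measurable_Rd; exact: continuous_tau. Qed.

Lemma tau_preimage_measurable (I : interval R) :
  measurable (Om `&` [set x | tau p x1 x2 x \in I] : set (Rd R d)).
Proof.
apply: measurableI => //; rewrite -[X in measurable X]setTI.
by apply: (measurable_tau measurableT (measurable_itv I)).
Qed.

Lemma band_measurable s t : measurable (band s t : set (Rd R d)).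
Proof.
have -> : band s t = Om `&` [set x | tau p x1 x2 x \in `[s, t[].
  by congr (_ `&` _); apply/seteqP; split => x /=; rewrite in_itv.
exact: tau_preimage_measurable.
Qed.

Definition left_band_lipschitz (tbar : R) : Prop :=
  exists del C : R, [/\ 0 < del, 0 <= C & forall t, tbar - del <= t <= tbar ->
    fine (lam (band t tbar)) <= C * (tbar - t)].

Lemma left_band_empty tbar del : 0 < del ->
  (forall t, tbar - del <= t <= tbar -> band t tbar = set0) ->
  left_band_lipschitz tbar.
Proof.
move=> del0 H; exists del, 0; split => // t /H ->.
by rewrite measure0 mul0r.
Qed.

Lemma cube_fin (M : R) : (lam (cube M) < +oo)%E.
Proof. exact: box_fin. Qed.

(* Translating the band by multiples of s (x2 - x1), with 2 c s equal to its
   height, moves tau past tbar; the translates are disjoint in a fixed cube. *)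
Lemma left_band_of_slope (tbar del c : R) : 0 < del -> 0 < c ->
  (forall x, Om x -> tbar - del <= tau p x1 x2 x <= tbar ->
     c <= midgap p (x - x1) (x - x2)) ->
  left_band_lipschitz tbar.
Proof.
move=> del0 c0 Hc; have [M M0 OmM] := bounded_sub_cube HOm_bdd.
pose u := x2 - x1; pose U := \sum_i `|u 0 i|; pose B : set 'rV[R]_d := cube (M + U).
have uU i : `|u 0 i| <= U by rewrite /U (bigD1 i)//= lerDl; exact: sumr_ge0.
have mB : measurable (B : set (Rd R d)) by exact: box_measurable.
have Boo : (lam B < +oo)%E by exact: cube_fin.
have V0 : 0 <= fine (lam B) by rewrite fine_ge0.
exists del, (2 * fine (lam B) / c); split => //.
  by rewrite divr_ge0// ?(ltW c0)// mulr_ge0.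
move=> t /andP[tdel]; rewrite le_eqVlt => /orP[/eqP->|tlt].
  rewrite (_ : band tbar tbar = set0) ?measure0 ?subrr ?mulr0//.
  by apply/seteqP; split => // x [_ /= /andP[h h']]; have := le_lt_trans h h'; rewrite ltxx.
set A := band t tbar; have mA : measurable (A : set (Rd R d)) by exact: band_measurable.
pose s := (tbar - t) / (2 * c).
have s0 : 0 < s by rewrite divr_gt0 ?mulr_gt0 ?subr_gt0.
have sc : 2 * s * c = tbar - t.
  by rewrite mulrAC [2 * c * _]mulrC divfK// gt_eqF// mulr_gt0.
have -> : 2 * fine (lam B) / c * (tbar - t) = 4 * s * fine (lam B).
  by rewrite -sc; have := divfK (lt0r_neq0 c0) (2 * fine (lam B)); 
    set q := _ / c => qc; rewrite mulrC -!mulrA (mulrC c) qc; ring.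
have shift k x : k%:R * s <= 2^-1 -> A x -> B (x + k%:R *: (s *: u)).
  move=> ks [Ox _]; apply/cubeP => i.
  have -> : (x + k%:R *: (s *: u)) 0 i = x 0 i + k%:R * s * u 0 i by rewrite !mxE mulrA.
  have ks0 : 0 <= k%:R * s by apply: mulr_ge0 => //; exact: ltW.
  have /cubeP/(_ i) xM := OmM _ Ox; rewrite (le_trans (ler_normD _ _))// lerD//.
  rewrite normrM (ger0_norm ks0) (le_trans _ (uU i))// ler_piMl//; lra.
have AB : A `<=` B.
  by move=> x Ax; have := shift 0%N x; rewrite mul0r scale0r addr0; apply => //; lra.
have [s2|s2] := ltP 2^-1 s.
  have : fine (lam A) <= fine (lam B).
    rewrite fine_le// ?ge0_fin_numE//; first last.
    - by apply: le_measure => //; exact/mem_set.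
    - by rewrite (le_lt_trans _ Boo)//; apply: le_measure => //; exact/mem_set.
  by nra.
pose y := (2 * s)^-1; have y1 : 1 <= y by rewrite invf_ge1//; lra.
have ys : y * (2 * s) = 1 by rewrite mulVf// gt_eqF//; lra.
have y0 : 0 <= y by lra.
pose N := Num.truncn y.
have /andP[Ny yN] := truncn_itv y0; rewrite -/N in Ny yN.
have N1 : 1 <= N%:R :> R by rewrite ler1n truncn_gt0.
have small k : (k < N)%N -> k%:R * s <= 2^-1.
  move=> kN; have : k%:R <= N%:R :> R by rewrite ler_nat ltnW.
  by nra.
have H : N%:R * fine (lam A) <= fine (lam B).
  apply: (@disjoint_translates _ _ _ Hlam A B (s *: u)) => //.
  - by move=> k x kN; apply: shift; exact: small.
  - move=> k x /andP[k0 kN] [Ox /andP[tx xt]] [_ /andP[_]].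
    apply/negP; rewrite -leNgt scalerA.
    have ks : 0 <= k%:R * s <= 2^-1 by rewrite small// andbT; apply: mulr_ge0 => //; exact: ltW.
    apply: le_trans (tau_shift x1 x2 x Hp ks).
    have cx : c <= midgap p (x - x1) (x - x2) by apply: Hc => //; apply/andP; lra.
    have k1 : 1 <= k%:R :> R by rewrite ler1n.
    have : s * c <= (k%:R * s) * midgap p (x - x1) (x - x2).
      by rewrite ler_pM// ?(ltW s0) ?(ltW c0)// ler_peMl// ltW.
    by lra.
have A0 : 0 <= fine (lam A) by rewrite fine_ge0.
have : y <= 2 * N%:R by move: yN; rewrite -natr1; lra.
move=> y2N; have : 1 <= 4 * s * N%:R by nra.
by nra.
Qed.

Lemma left_band_regular tbar : x1 != x2 ->
  (p = 1 -> `|tbar| != enorm (x1 - x2)) -> left_band_lipschitz tbar.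
Proof.
move=> x12 tL; have [M M0 OmM] := bounded_sub_cube HOm_bdd.
have [del del0 Hdel] : exists2 del, 0 < del & p = 1 ->
    forall t, tbar - del <= t <= tbar -> `|t| != enorm (x1 - x2).
  have [p1|p1] := eqVneq p 1; last by exists 1 => // /eqP; rewrite (negbTE p1).
  have tL' := tL p1; exists (`| `|tbar| - enorm (x1 - x2)| / 2).
    by rewrite divr_gt0// normr_gt0 subr_eq0.
  move=> _ t /andP[t1 t2]; apply/negP => /eqP tE.
  have D0 : 0 < `| `|tbar| - enorm (x1 - x2)| by rewrite normr_gt0 subr_eq0.
  have : `| `|tbar| - enorm (x1 - x2)| <= `|tbar - t|.
    by rewrite -tE ler_dist_dist.
  rewrite (ger0_norm (x := tbar - t)) ?subr_ge0//; lra.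
pose K := cube M `&` (tau p x1 x2 @^-1` `[tbar - del, tbar]%classic).
have cK : compact K.
  apply: compact_closedI; first exact: cube_compact.
  apply: preimage_closed; last exact: interval_closed.
  by move=> x _; exact: continuous_tau.
have [c c0 Hc] : exists2 c, 0 < c & forall x, K x -> c <= midgap p (x - x1) (x - x2).
  apply: compact_pos_min => //; first exact: continuous_midgap.
  move=> x [_ /=]; rewrite in_itv/= => tx; apply: midgap_gt0 => //.
    by apply: contra x12 => /eqP/addrI/oppr_inj ->.
  move=> p1; have := Hdel p1 _ tx; rewrite tauE p1 !powRr1 ?enorm_ge0//.
  have -> : x - x1 - (x - x2) = - (x1 - x2) by apply/rowP => i; rewrite !mxE; lra.
  by rewrite enormN.
apply: (left_band_of_slope del0 c0) => x Ox tx; apply: Hc; split; first exact: OmM.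
by rewrite /= in_itv.
Qed.

Lemma tau_le_dist x : p = 1 -> `|tau p x1 x2 x| <= enorm (x1 - x2).
Proof.
move=> p1; rewrite tauE p1 !powRr1 ?enorm_ge0// ler_norml.
have t1 : enorm (x - x1) <= enorm (x - x2) + enorm (x1 - x2).
  rewrite -(enormN (x1 - x2)) opprB (le_trans _ (enormD_le _ _))//.
  by rewrite addrA subrK.
have t2 : enorm (x - x2) <= enorm (x - x1) + enorm (x1 - x2).
  by rewrite (le_trans _ (enormD_le _ _))// addrA subrK.
by apply/andP; split; lra.
Qed.

(* The maximal level set of tau for p = 1 is a ray, hence null when d > 1. *)
Lemma max_level_null : p = 1 -> x1 != x2 -> (1 < d)%N ->
  lam (Om `&` [set x | enorm (x1 - x2) <= tau p x1 x2 x]) = 0%E.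
Proof.
move=> p1 x12 d1; set S := Om `&` _; have [M M0 OmM] := bounded_sub_cube HOm_bdd.
have mS : measurable (S : set (Rd R d)).
  have -> : S = Om `&` [set x | tau p x1 x2 x \in `[enorm (x1 - x2), +oo[].
    by congr (_ `&` _); apply/seteqP; split => x /=; rewrite in_itv/= andbT.
  exact: tau_preimage_measurable.
pose u := x2 - x1.
have [i ui] : exists i, u 0 i != 0.
  apply: contrapT => /forallNP H; move: x12; rewrite eq_sym -subr_eq0.
  by move=> /eqP; apply; apply/rowP => i; rewrite [RHS]mxE; apply/eqP/negPn/negP/H.
have [j ji] := exists_other_index i d1.
have par x : S x -> (x - x2) 0 i * u 0 j = (x - x2) 0 j * u 0 i.
  move=> [_ /= tx]; apply: enormD_eq_parallel.
  rewrite /u addrA subrK; move: tx (tau_le_dist x p1).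
  rewrite tauE p1 !powRr1 ?enorm_ge0// -(enormN (x1 - x2)) opprB => tx.
  by move=> /(le_trans (ler_norm _)) tx'; lra.
pose B : set 'rV[R]_d := cube (M + 1).
have Boo : (lam B < +oo)%E by exact: cube_fin.
have mB : measurable (B : set (Rd R d)) by exact: box_measurable.
have SB : S `<=` B.
  move=> x [Ox _]; apply/cubeP => k; have /cubeP/(_ k) := OmM _ Ox; lra.
have finS : lam S \is a fin_num.
  rewrite ge0_fin_numE// (le_lt_trans _ Boo)//; apply: le_measure => //; exact/mem_set.
have H (N : nat) : N.+1%:R * fine (lam S) <= fine (lam B).
  have N0 : 0 < N.+1%:R :> R by [].
  apply: (@disjoint_translates _ _ _ Hlam S B (N.+1%:R^-1 *: delta_mx 0 j)) => //.
  - move=> k x kN [Ox _]; apply/cubeP => l; rewrite !mxE.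
    have /cubeP/(_ l) xM := OmM _ Ox; rewrite (le_trans (ler_normD _ _))// lerD//.
    rewrite mulrA normrM ger0_norm ?mulr_ge0 ?invr_ge0//.
    rewrite -[leRHS]mulr1 ler_pM ?mulr_ge0 ?invr_ge0//.
      by rewrite ler_pdivrMr// mul1r ler_nat ltnW.
    by case: (_ && _); rewrite ?normr0 ?normr1 ?ler01.
  - move=> k x /andP[k0 kN] Sx Sy; have := par _ Sy; have := par _ Sx.
    have ui' : x2 0 i - x1 0 i != 0 by move: ui; rewrite !mxE.
    rewrite !mxE !eqxx eq_sym (negbTE ji)/= mulr0 mulr0 mulr1 addr0.
    move=> -> /eqP; rewrite -subr_eq0 -mulrBl mulf_eq0 (negbTE ui') orbF.
    rewrite [X in _ - X]addrAC opprD addrA subrr add0r oppr_eq0 mulf_eq0 invr_eq0.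
    by rewrite !pnatr_eq0 orbF gtn_eqF.
have S0 : 0 <= fine (lam S) by rewrite fine_ge0.
rewrite -(fineK finS); congr (_%:E); apply/eqP; rewrite eq_le S0 andbT leNgt.
apply/negP => Sp.
have := H (Num.truncn (fine (lam B) / fine (lam S))).
rewrite leNgt => /negP; apply; rewrite -ltr_pdivrMr//.
exact: truncnS_gt.
Qed.

End Bands.

Lemma left_band_dim1 (R : realType) (lam : {measure set (Rd R 1) -> \bar R})
  (Om : set 'rV[R]_1) (x1 x2 : 'rV[R]_1) : is_lebesgue lam ->
  measurable (Om : set (Rd R 1)) -> x1 != x2 ->
  left_band_lipschitz lam Om 1 x1 x2 (enorm (x1 - x2)).
Proof.
move=> Hlam mOm x12; set L := enorm (x1 - x2).
have L0 : 0 < L by rewrite lt_def enorm_eq0 subr_eq0 x12 enorm_ge0.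
exists L, 1; split => // t /andP[]; rewrite subrr => t0 tL.
have e1 (v : 'rV[R]_1) : enorm v = `|v 0 0|.
  by rewrite /enorm /dot big_ord1 -expr2 sqrtr_sqr.
have LE : L = `|x1 0 0 - x2 0 0| by rewrite /L e1 !mxE.
pose a : 'rV[R]_1 := const_mx (if x1 0 0 <= x2 0 0 then (x1 0 0 + x2 0 0 + t) / 2 else x2 0 0).
pose b : 'rV[R]_1 := const_mx (if x1 0 0 <= x2 0 0 then x2 0 0 else (x1 0 0 + x2 0 0 - t) / 2).
have [ab ba] : a 0 0 <= b 0 0 /\ b 0 0 - a 0 0 <= 1 * (L - t).
  rewrite !mxE; move: tL; rewrite LE; case: ifPn => h.
    by rewrite ler0_norm ?subr_le0// => ?; split; lra.
  by move: h; rewrite -ltNge => h; rewrite gtr0_norm ?subr_gt0// => ?; split; lra.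
have sub : band Om 1 x1 x2 t L `<=` box a b.
  move=> x [_ /=]; rewrite tauE !powRr1 ?enorm_ge0// !e1 LE !mxE => H i.
  rewrite ord1 !mxE; move: H.
  case: ifPn => h; case: (ger0P (x 0 0 - x1 0 0)); case: (ger0P (x 0 0 - x2 0 0));
    case: (ger0P (x1 0 0 - x2 0 0)); move: h; rewrite -?ltNge => ? ? ? ? /andP[? ?];
    apply/andP; split; lra.
have bE : lam (box a b) = (b 0 0 - a 0 0)%:E.
  by rewrite Hlam ?big_ord1// => i; rewrite ord1.
have mb : measurable (band Om 1 x1 x2 t L : set (Rd R 1)) by exact: band_measurable.
have le : (lam (band Om 1 x1 x2 t L) <= lam (box a b))%E.
  by apply: le_measure => //; apply/mem_set => //; exact: box_measurable.
apply: le_trans ba; rewrite -[leRHS]/(fine (b 0 0 - a 0 0)%:E) -bE.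
by apply: fine_le => //; rewrite ?bE// ge0_fin_numE// (le_lt_trans le)// bE ltry.
Qed.

Lemma left_lipschitz_or_right_null (R : realType) (d : nat)
  (lam : {measure set (Rd R d) -> \bar R}) (Om : set 'rV[R]_d) (p : R)
  (x1 x2 : 'rV[R]_d) (tbar : R) : is_lebesgue lam ->
  measurable (Om : set (Rd R d)) -> bounded_set Om -> 1 <= p ->
  (x1 = x2 -> tbar != 0) ->
  left_band_lipschitz lam Om p x1 x2 tbar \/
  lam (Om `&` [set x | tbar <= tau p x1 x2 x]) = 0%E.
Proof.
move=> Hlam mOm bOm p1 tbar0; have [x12|x12] := eqVneq x1 x2.
  left; have {}tbar0 := tbar0 x12.
  apply: (@left_band_empty _ _ _ _ _ _ _ _ (`|tbar| / 2)).
    by rewrite divr_gt0// normr_gt0.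
  move=> t /andP[t1 t2]; apply/seteqP; split => // x [_ /=].
  rewrite /tau x12 subrr => /andP[h h']; move: t1; rewrite gtr0_norm//; lra.
have [[pe tL]|H] := pselect (p = 1 /\ `|tbar| = enorm (x1 - x2)); last first.
  by left; apply: left_band_regular => // pe; apply/eqP => tL; apply: H.
have L0 : 0 < enorm (x1 - x2).
  by rewrite lt_def enorm_eq0 subr_eq0 x12 enorm_ge0.
have [tn|tp] := lerP tbar 0.
  left; apply: (@left_band_empty _ _ _ _ _ _ _ _ 1) => // t _.
  apply/seteqP; split => // x [_ /= /andP[_ h]].
  have := tau_le_dist x1 x2 x pe; rewrite -tL ler_norml => /andP[+ _].
  by rewrite ler0_norm// opprK leNgt h.
have {tL} tE : tbar = enorm (x1 - x2) by rewrite -tL gtr0_norm.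
have [d1|d1] := ltnP 1 d; first by right; rewrite tE; exact: max_level_null.
left; rewrite tE pe; clear tE.
case: d lam Om x1 x2 Hlam mOm x12 d1 {bOm tbar0 L0} => [|[|//]] lam Om x1 x2 Hlam mOm x12 _.
  by move: x12; rewrite (_ : x1 = x2) ?eqxx//; apply/rowP => -[].
exact: left_band_dim1.
Qed.

Section Masses.
Variables (R : realType) (d : nat) (lam : {measure set (Rd R d) -> \bar R}).
Variables (Om : set 'rV[R]_d) (f : 'rV[R]_d -> R) (p : R) (x1 x2 : 'rV[R]_d).
Hypothesis HOm_meas : measurable (Om : set (Rd R d)).
Hypothesis Hf_meas : measurable_fun (Om : set (Rd R d)) (f : Rd R d -> R).
Hypothesis Hf_ge0 : forall x, Om x -> 0 <= f x.
Hypothesis Hf_int : (\int[lam]_(x in (Om : set (Rd R d))) (f x)%:E)%E = 1%E.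
Hypothesis Hp : 1 <= p.

Local Notation tau := (tau p x1 x2).
Local Notation band := (band Om p x1 x2).
Local Notation m := (Defs.mfun lam Om f p x1 x2).

Let mass (A : set 'rV[R]_d) : R :=
  fine (\int[lam]_(x in (A : set (Rd R d))) (f x)%:E).

Let Hf_measE : measurable_fun (Om : set (Rd R d)) ((fun x => (f x)%:E) : Rd R d -> \bar R).
Proof. exact/measurable_EFinP. Qed.

Lemma integral_density_fin (A : set 'rV[R]_d) : measurable (A : set (Rd R d)) ->
  A `<=` Om -> (\int[lam]_(x in (A : set (Rd R d))) (f x)%:E)%E \is a fin_num.
Proof.
move=> mA AOm; rewrite ge0_fin_numE; last first.
  by apply: integral_ge0 => x Ax; rewrite lee_fin Hf_ge0//; exact: AOm.
rewrite (@le_lt_trans _ _ 1%E) ?ltry// -Hf_int.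
by apply: ge0_subset_integral => // x Ox; rewrite lee_fin Hf_ge0.
Qed.

Lemma mass_ge0 A : A `<=` Om -> 0 <= mass A.
Proof.
move=> AOm; rewrite fine_ge0//.
by apply: integral_ge0 => x Ax; rewrite lee_fin Hf_ge0//; exact: AOm.
Qed.

Lemma mass_le1 A : measurable (A : set (Rd R d)) -> A `<=` Om -> mass A <= 1.
Proof.
move=> mA AOm; rewrite -lee_fin /mass fineK ?integral_density_fin// -Hf_int.
by apply: ge0_subset_integral => // x Ox; rewrite lee_fin Hf_ge0.
Qed.

Lemma mass_le_lam A M : measurable (A : set (Rd R d)) -> A `<=` Om ->
  (forall x, Om x -> f x <= M) -> (lam A < +oo)%E -> mass A <= M * fine (lam A).
Proof.
move=> mA AOm HM Aoo; have finA : lam A \is a fin_num by rewrite ge0_fin_numE.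
rewrite -lee_fin /mass fineK ?integral_density_fin// EFinM fineK//.
rewrite -integral_cst//; apply: ge0_le_integral => //.
- by move=> x Ax; rewrite lee_fin Hf_ge0//; exact: AOm.
- exact: measurable_funS Hf_measE.
- by move=> x Ax; rewrite lee_fin HM//; exact: AOm.
Qed.

Lemma sublevel_measurable t :
  measurable (Om `&` [set y | tau y < t] : set (Rd R d)).
Proof.
have -> : Om `&` [set y | tau y < t] = Om `&` [set x | tau x \in `]-oo, t[].
  by congr (_ `&` _); apply/seteqP; split => x /=; rewrite in_itv.
exact: tau_preimage_measurable.
Qed.

Lemma mfun01 t : 0 <= m t <= 1.
Proof.
apply/andP; split; first by apply: mass_ge0 => x [].
by apply: mass_le1; [exact: sublevel_measurable|move=> x []].
Qed.

Lemma mfun_band s t : s <= t -> m t = m s + mass (band s t).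
Proof.
move=> st; have mb := @band_measurable _ _ Om p x1 x2 HOm_meas Hp s t.
have ms := sublevel_measurable s.
rewrite /Defs.mfun /mass -fineD ?integral_density_fin//; try by move=> x [].
have E : Om `&` [set y | tau y < t] = (Om `&` [set y | tau y < s]) `|` band s t.
  apply/seteqP; split => x /=.
    move=> [Ox xt]; case: (ltP (tau x) s) => xs; [left|right] => //.
    by split => //=; rewrite xs.
  by move=> [[Ox xs]|[Ox /= /andP[_ ?]]]; split => //; exact: lt_le_trans xs st.
congr (fine _); rewrite E ge0_integral_setU//.
- by apply: measurable_funS Hf_measE => // x [[]|[]].
- by move=> x [[Ox _]|[Ox _]]; rewrite lee_fin Hf_ge0.
- apply/disj_setPS => x [[_ /= xs] [_ /= /andP[sx _]]].
  by have := lt_le_trans xs sx; rewrite ltxx.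
Qed.

Lemma mfun_mono s t : s <= t -> m s <= m t.
Proof. by move=> st; rewrite (mfun_band st) lerDl mass_ge0// => x []. Qed.

Lemma mfun_left_lipschitz tbar : is_lebesgue lam -> bounded_set Om ->
  (exists M, forall x, Om x -> f x <= M) ->
  left_band_lipschitz lam Om p x1 x2 tbar ->
  exists2 C, 0 <= C & forall t, t <= tbar -> m tbar - m t <= C * (tbar - t).
Proof.
move=> Hlam bOm [M HM] [del [C [del0 C0 HC]]].
have [B _ OmB] := bounded_sub_cube bOm.
exists (`|M| * C + del^-1).
  by apply: addr_ge0; [exact: mulr_ge0|rewrite invr_ge0 ltW].
move=> t tt; have [tdel|tdel] := leP (tbar - del) t.
  rewrite (mfun_band tt) addrAC subrr add0r.
  have mb := @band_measurable _ _ Om p x1 x2 HOm_meas Hp t tbar.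
  have boo : (lam (band t tbar) < +oo)%E.
    apply: le_lt_trans (box_fin Hlam (const_mx (- B)) (const_mx B)).
    apply: le_measure; [exact/mem_set|apply/mem_set; exact: box_measurable|].
    by move=> x [Ox _]; exact: OmB.
  rewrite (@le_trans _ _ (`|M| * fine (lam (band t tbar))))//.
    apply: mass_le_lam => //; first by move=> x [].
    by move=> x Ox; rewrite (le_trans (HM _ Ox))// ler_norm.
  rewrite mulrDl -mulrA ler_wpDr// ?mulr_ge0 ?invr_ge0 ?(ltW del0) ?subr_ge0//.
  by rewrite ler_wpM2l// HC// tdel.
have /andP[? ?] := mfun01 t; have /andP[? ?] := mfun01 tbar.
apply: (@le_trans _ _ 1); first by lra.
rewrite mulrDl ler_wpDl ?mulr_ge0 ?subr_ge0//.
by rewrite mulrC ler_pdivlMr// mul1r; lra.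
Qed.

Lemma mfun_right_const tbar t : lam (Om `&` [set x | tbar <= tau x]) = 0%E ->
  (exists M, forall x, Om x -> f x <= M) -> tbar <= t -> m t = m tbar.
Proof.
move=> nul [M HM] tt; rewrite (mfun_band tt).
have mb := @band_measurable _ _ Om p x1 x2 HOm_meas Hp tbar t.
have b0 : lam (band tbar t) = 0%E.
  apply/eqP; rewrite eq_le measure_ge0 andbT -nul.
  apply: le_measure; [exact/mem_set|apply/mem_set|].
    have -> : Om `&` [set x | tbar <= tau x] = Om `&` [set x | tau x \in `[tbar, +oo[].
      by congr (_ `&` _); apply/seteqP; split => x /=; rewrite in_itv/= andbT.
    exact: tau_preimage_measurable.
  by move=> x [Ox /= /andP[? _]].
have bO : band tbar t `<=` Om by move=> x [].
have h0 := mass_ge0 bO.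
have : mass (band tbar t) <= M * fine (lam (band tbar t)).
  by apply: mass_le_lam => //; rewrite b0.
by rewrite b0 mulr0; lra.
Qed.

Variables (h1 h2 : R -> R) (rho : R) (psi0 : 'rV[R]_d -> R).
Hypothesis rho01 : 0 < rho < 1.
Hypothesis psi0_meas : measurable_fun (Om : set (Rd R d)) (psi0 : Rd R d -> R).
Hypothesis psi0_01 : forall x, Om x -> 0 <= psi0 x <= 1.

Local Notation psi := (psi lam Om f p x1 x2 h1 h2 rho psi0).

Definition day_mass j : R :=
  fine (\int[lam]_(x in (Om : set (Rd R d))) ((1 - psi j x) * f x)%:E).

Definition day_threshold j : R := h2 (1 - day_mass j) - h1 (day_mass j).

Lemma psiS j x : psi j.+1 x =
  if tau x < day_threshold j then rho * psi j x else 1 - rho * (1 - psi j x).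
Proof. by []. Qed.

Lemma psi01 j x : Om x -> 0 <= psi j x <= 1.
Proof.
move=> Ox; elim: j => [|j /andP[IH0 IH1]]; first exact: psi0_01.
have /andP[r0 r1] := rho01.
by rewrite psiS; case: ifP => _; apply/andP; split; nra.
Qed.

Lemma psi_measurable j : measurable_fun (Om : set (Rd R d)) (psi j : Rd R d -> R).
Proof.
elim: j => [//|j IH].
rewrite (_ : psi j.+1 = fun x => if tau x < day_threshold j then rho * psi j x
  else 1 - rho * (1 - psi j x)); last by apply/funext => x; rewrite psiS.
apply: measurable_fun_if => //.
- apply: measurable_fun_ltr; last exact: measurable_cst.
  by apply: measurable_funS (@measurable_tau _ _ p x1 x2 Hp).
- apply: (@measurable_funS _ _ (Rd R d) R Om) => //.
  by apply: measurable_funM => //; exact: measurable_cst.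
- apply: (@measurable_funS _ _ (Rd R d) R Om) => //.
  apply: measurable_funB; first exact: measurable_cst.
  apply: measurable_funM; first exact: measurable_cst.
  by apply: measurable_funB => //; exact: measurable_cst.
Qed.

Let day_meas j : measurable_fun (Om : set (Rd R d)) ((fun x => ((1 - psi j x) * f x)%:E) : Rd R d -> \bar R).
Proof.
apply/measurable_EFinP.
apply: measurable_funM => //.
apply: measurable_funB; first exact: measurable_cst.
exact: psi_measurable.
Qed.

Let day_ge0 j x : Om x -> (0 <= ((1 - psi j x) * f x)%:E)%E.
Proof.
by move=> Ox; have /andP[_ ?] := psi01 j Ox; rewrite lee_fin mulr_ge0 ?Hf_ge0 ?subr_ge0.
Qed.

Let day_le1 j : (\int[lam]_(x in (Om : set (Rd R d))) ((1 - psi j x) * f x)%:E <= 1)%E.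
Proof.
rewrite -Hf_int; apply: ge0_le_integral => //; first exact: day_ge0.
move=> x Ox; have /andP[? ?] := psi01 j Ox; rewrite lee_fin ler_piMl ?Hf_ge0//; lra.
Qed.

Let day_fin j : (\int[lam]_(x in (Om : set (Rd R d))) ((1 - psi j x) * f x)%:E)%E
  \is a fin_num.
Proof.
rewrite ge0_fin_numE; first by rewrite (le_lt_trans (day_le1 j)) ?ltry.
by apply: integral_ge0 => x; exact: day_ge0.
Qed.

Lemma day_mass01 j : 0 <= day_mass j <= 1.
Proof.
apply/andP; split; first by rewrite fine_ge0//; apply: integral_ge0 => x; exact: day_ge0.
by rewrite -lee_fin fineK.
Qed.

Lemma day_massS j :
  day_mass j.+1 = rho * day_mass j + (1 - rho) * m (day_threshold j).
Proof.
have /andP[r0 r1] := rho01; set t := day_threshold j.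
pose g x := if tau x < t then f x else 0.
have gE : (\int[lam]_(x in (Om `&` [set y | (tau y < t)%R] : set (Rd R d))) (f x)%:E =
    \int[lam]_(x in (Om : set (Rd R d))) (g x)%:E)%E.
  rewrite integral_mkcondr; apply: eq_integral => x _; rewrite /patch.
  have -> : (x \in [set y | tau y < t]) = (tau x < t) by apply/idP/idP; rewrite inE.
  by rewrite /g; case: ifP.
have mg : measurable_fun (Om : set (Rd R d)) ((fun x => (g x)%:E) : Rd R d -> \bar R).
  apply/measurable_EFinP; apply: measurable_fun_if => //.
  - apply: measurable_fun_ltr; last exact: measurable_cst.
    by apply: measurable_funS (@measurable_tau _ _ p x1 x2 Hp).
  - by apply: measurable_funS Hf_meas.
have g0 x : Om x -> (0 <= (g x)%:E)%E.
  by move=> Ox; rewrite lee_fin /g; case: ifP => // _; exact: Hf_ge0.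
have finS := integral_density_fin (sublevel_measurable t) (@subIsetl _ _ _).
rewrite /day_mass /Defs.mfun.
transitivity (fine (rho%:E * \int[lam]_(x in (Om : set (Rd R d))) ((1 - psi j x) * f x)%:E
  + (1 - rho)%:E * \int[lam]_(x in (Om : set (Rd R d))) (g x)%:E)%E); last first.
  by rewrite -gE fineD ?fin_numM// !fineM.
congr fine; rewrite -!ge0_integralZl_EFin//; [|by rewrite subr_ge0 ltW|exact: day_ge0|exact: ltW].
rewrite -ge0_integralD//.
- apply: eq_integral => x _; rewrite psiS -/t /g -!EFinM -EFinD.
  by congr (_%:E); case: ifP => _; ring.
- by move=> x Ox; rewrite mule_ge0 ?day_ge0// lee_fin ltW.
- by apply: measurable_funeM.
- by move=> x Ox; rewrite mule_ge0 ?g0// lee_fin subr_ge0 ltW.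
- by apply: measurable_funeM.
Qed.

End Masses.

(* In the second alternative the mass is constant to the right of tbar, so the
   trapping side of the relaxation is the negative one. *)
Lemma day_mass_cvg (R : realType) (d : nat)
  (lam : {measure set (Rd R d) -> \bar R}) (Om : set 'rV[R]_d)
  (f : 'rV[R]_d -> R) (p : R) (x1 x2 : 'rV[R]_d) (h1 h2 : R -> R) (tbar L : R) :
  is_lebesgue lam -> measurable (Om : set (Rd R d)) -> bounded_set Om ->
  measurable_fun (Om : set (Rd R d)) (f : Rd R d -> R) ->
  (forall x, Om x -> 0 <= f x) -> (exists M : R, forall x, Om x -> f x <= M) ->
  (\int[lam]_(x in (Om : set (Rd R d))) (f x)%:E)%E = 1%E -> 1 <= p ->
  (x1 = x2 -> tbar != 0) ->
  let g s := h2 (1 - s) - h1 s in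
  (forall a b, 0 <= a -> a <= b -> b <= 1 -> g b <= g a <= g b + L * (b - a)) ->
  Gfun lam Om f p x1 x2 h1 h2 tbar = tbar ->
  exists rhobar : R, 0 < rhobar < 1 /\
    forall rho : R, rhobar < rho < 1 -> forall psi0 : 'rV[R]_d -> R,
      measurable_fun (Om : set (Rd R d)) (psi0 : Rd R d -> R) ->
      (forall x, Om x -> 0 <= psi0 x <= 1) ->
      forall eps, 0 < eps -> exists N, forall j, (N <= j)%N ->
        `|day_mass lam Om f p x1 x2 h1 h2 rho psi0 j
          - Defs.mfun lam Om f p x1 x2 tbar| < eps.
Proof.
move=> Hlam mOm bOm mf f0 fM f1 p1 t0 g gP gt.
set m := Defs.mfun lam Om f p x1 x2; set sbar := m tbar.
have /andP[s0 s1] : 0 <= sbar <= 1 by exact: mfun01.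
have gs : g sbar = tbar by exact: gt.
have mono s t : s <= t -> m s <= m t by exact: mfun_mono.
have [/(mfun_left_lipschitz mOm mf f0 f1 p1 Hlam bOm fM)[C C0 HC]|nul] :=
    left_lipschitz_or_right_null Hlam mOm bOm p1 t0.
  have L0 : 0 <= L.
    by have := gP 0 1 (lexx _) ler01 (lexx _); lra.
  pose D := C * L; have D0 : 0 <= D by exact: mulr_ge0.
  exists ((D + 1) / (D + 2)); split.
    rewrite divr_gt0/=; [|lra|lra]; rewrite ltr_pdivrMr; lra.
  move=> rho /andP[rr r1] psi0 mpsi psi01.
  rewrite ltr_pdivrMr in rr; last by lra.
  have r0 : 0 < rho by nra.
  have rho01 : 0 < rho < 1 by rewrite r0.
  have massP j : 0 <= day_mass lam Om f p x1 x2 h1 h2 rho psi0 j <= 1 by exact: day_mass01.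
  set s := day_mass lam Om f p x1 x2 h1 h2 rho psi0.
  apply: (@relaxation_cvg _ rho D (fun j => s j - sbar) (fun j => m (g (s j)) - sbar)) => //.
  - by nra.
  - by move=> j; rewrite /s day_massS// -/m -/s -/(g (s j)) /g; ring.
  - move=> j; rewrite subr_ge0 => sj; have /andP[_ sj1] := massP j.
    have /andP[g1 g2] := gP _ _ s0 sj sj1; rewrite gs in g1 g2.
    have := HC _ g1; have := mono _ _ g1; rewrite -/m -/sbar => h h'.
    have : C * (tbar - g (s j)) <= C * (L * (s j - sbar)) by rewrite ler_wpM2l//; lra.
    by rewrite mulrA -/D => h''; apply/andP; split; lra.
  - move=> j; rewrite subr_le0 => sj; have /andP[sj0 _] := massP j.
    have /andP[g1 _] := gP _ _ sj0 sj s1; rewrite gs in g1.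
    by rewrite subr_ge0; exact: mono.
exists 2^-1; split; first by apply/andP; split; lra.
move=> rho /andP[rr r1] psi0 mpsi psi01.
have rho01 : 0 < rho < 1 by apply/andP; split; lra.
have massP j : 0 <= day_mass lam Om f p x1 x2 h1 h2 rho psi0 j <= 1 by exact: day_mass01.
set s := day_mass lam Om f p x1 x2 h1 h2 rho psi0.
move=> eps eps0.
have [||||N HN] := @relaxation_cvg _ rho 0 (fun j => - (s j - sbar))
    (fun j => - (m (g (s j)) - sbar)) rho01 _ _ _ _ _ eps0.
- by lra.
- by move=> j; rewrite /s day_massS// -/m -/s -/(g (s j)) /g; ring.
- move=> j; rewrite opprB subr_ge0 => sj; have /andP[sj0 _] := massP j.
  have /andP[g1 _] := gP _ _ sj0 sj s1; rewrite gs in g1.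
  have -> : m (g (s j)) = sbar by exact: (mfun_right_const mOm mf f0 f1 p1 nul fM g1).
  by apply/andP; split; lra.
- move=> j; rewrite opprB subr_le0 => sj; have /andP[_ sj1] := massP j.
  have /andP[g1 _] := gP _ _ s0 sj sj1; rewrite gs in g1.
  by rewrite opprB subr_ge0; exact: mono.
by exists N => j /HN; rewrite normrN.
Qed.

Theorem theorem5p5 (R : realType) (d : nat)
  (lam : {measure set (Rd R d) -> \bar R}) (Hlam : is_lebesgue lam)
  (Om : set 'rV[R]_d) (HOm_meas : measurable (Om : set (Rd R d)))
  (HOm_bdd : bounded_set Om)
  (f : 'rV[R]_d -> R)
  (Hf_meas : measurable_fun (Om : set (Rd R d)) (f : Rd R d -> R))
  (Hf_ge0 : forall x, Om x -> 0 <= f x)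
  (Hf_bdd : exists M : R, forall x, Om x -> f x <= M)
  (Hf_int : (\int[lam]_(x in (Om : set (Rd R d))) (f x)%:E)%E = 1%E)
  (p : R) (Hp : 1 <= p)
  (x1 x2 : 'rV[R]_d) (Hx1 : Om x1) (Hx2 : Om x2)
  (h1 h2 : R -> R)
  (Hh1_ge0 : forall a, 0 <= a <= 1 -> 0 <= h1 a)
  (Hh2_ge0 : forall a, 0 <= a <= 1 -> 0 <= h2 a)
  (Hh1_mono : forall a b, 0 <= a -> a <= b -> b <= 1 -> h1 a <= h1 b)
  (Hh2_mono : forall a b, 0 <= a -> a <= b -> b <= 1 -> h2 a <= h2 b)
  (Hh1_lip : exists L : R, forall a b, 0 <= a <= 1 -> 0 <= b <= 1 ->
     `|h1 a - h1 b| <= L * `|a - b|)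
  (Hh2_lip : exists L : R, forall a b, 0 <= a <= 1 -> 0 <= b <= 1 ->
     `|h2 a - h2 b| <= L * `|a - b|)
  (tbar : R) (Htbar : Gfun lam Om f p x1 x2 h1 h2 tbar = tbar) :
  exists rhobar : R, 0 < rhobar < 1 /\
    forall rho : R, rhobar < rho < 1 ->
    forall psi0 : 'rV[R]_d -> R,
      measurable_fun (Om : set (Rd R d)) (psi0 : Rd R d -> R) ->
      (forall x, Om x -> 0 <= psi0 x <= 1) ->
      forall K : set 'rV[R]_d, compact K ->
        K `<=` Om `\` [set x | tau p x1 x2 x = tbar] ->
        forall eps : R, 0 < eps ->
          exists N : nat, forall j : nat, (N <= j)%N ->
            forall x, K x ->
              `|psi lam Om f p x1 x2 h1 h2 rho psi0 j x - psibar p x1 x2 tbar x| < eps.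
Proof.
have [[x12 tb0]|Hreg] := pselect (x1 = x2 /\ tbar = 0).
  exists 2^-1; split; first by apply/andP; split; lra.
  move=> rho _ psi0 _ _ K _ KOm eps _; exists 0%N => j _ x /KOm[_ /=].
  by rewrite /tau x12 tb0 subrr.
have [[L1 HL1] [L2 HL2]] := (Hh1_lip, Hh2_lip).
pose g s := h2 (1 - s) - h1 s; pose L := L1 + L2.
have gP a b : 0 <= a -> a <= b -> b <= 1 -> g b <= g a <= g b + L * (b - a).
  move=> a0 ab b1.
  have k1 : h1 a <= h1 b by exact: Hh1_mono.
  have k2 : h2 (1 - b) <= h2 (1 - a) by apply: Hh2_mono; lra.
  have k3 : `|h1 b - h1 a| <= L1 * `|b - a|.
    by apply: HL1; apply/andP; split; lra.
  have k4 : `|h2 (1 - a) - h2 (1 - b)| <= L2 * `|1 - a - (1 - b)|.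
    by apply: HL2; apply/andP; split; lra.
  have e : 1 - a - (1 - b) = b - a by ring.
  move: k3 k4; rewrite e !ger0_norm ?subr_ge0// => k3 k4.
  by rewrite /g /L; apply/andP; split; lra.
have reg : x1 = x2 -> tbar != 0.
  by move=> x12; apply/eqP => tb0; apply: Hreg.
have [rhobar [rb01 Hcvg]] := day_mass_cvg Hlam HOm_meas HOm_bdd Hf_meas Hf_ge0 Hf_bdd
  Hf_int Hp reg gP Htbar.
exists rhobar; split => // rho rhoP psi0 mpsi psi0P K cK KOm eps eps0.
have rho01 : 0 < rho < 1 by move: rb01 rhoP => /andP[? ?] /andP[? ?]; apply/andP; split; lra.
have [del del0 Hdel] : exists2 c, 0 < c & forall x, K x -> c <= `|tau p x1 x2 x - tbar|.
  apply: compact_pos_min => // [x|x /KOm[_ /= ?]]; last by rewrite normr_gt0 subr_eq0; apply/eqP.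
  have FF := nbhs_filter_rV x; apply: cvg_norm; apply: cvgB; last exact: cvg_cst.
  exact: continuous_tau.
set s := day_mass lam Om f p x1 x2 h1 h2 rho psi0.
set sbar := Defs.mfun lam Om f p x1 x2 tbar.
have L0 : 0 <= L by have := gP 0 1 (lexx _) ler01 (lexx _); lra.
have L10 : 0 < L + 1 by lra.
have [N0 HN0] := Hcvg rho rhoP psi0 mpsi psi0P _ (divr_gt0 del0 L10).
have massP j : 0 <= s j <= 1 by exact: day_mass01.
have /andP[sb0 sb1] : 0 <= sbar <= 1 by exact: mfun01.
have near j : (N0 <= j)%N -> `|g (s j) - tbar| < del.
  move=> /HN0; rewrite -/s -/sbar ltr_pdivlMr// => sj.
  have gs : g sbar = tbar by exact: Htbar.
  have /andP[sj0 sj1] := massP j.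
  apply: le_lt_trans sj; rewrite -gs.
  have [h|/ltW h] := leP (s j) sbar.
    have /andP[g1 g2] := gP _ _ sj0 h sb1.
    by rewrite ger0_norm ?subr_ge0// ler0_norm ?subr_le0//; nra.
  have /andP[g1 g2] := gP _ _ sb0 h sj1.
  by rewrite ler0_norm ?subr_le0// ger0_norm ?subr_ge0//; nra.
set ps := psi lam Om f p x1 x2 h1 h2 rho psi0.
have step j x : (N0 <= j)%N -> K x ->
    ps j.+1 x - psibar p x1 x2 tbar x = rho * (ps j x - psibar p x1 x2 tbar x).
  move=> jN Kx; have := near _ jN; have := Hdel _ Kx.
  rewrite /ps psiS -/ps -[day_threshold _ _ _ _ _ _ _ _ _ _ _]/(g (s j)) /psibar.
  rewrite ltr_norml => h /andP[? ?]; move: h.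
  case: (ltP (tau p x1 x2 x) tbar) => h.
    rewrite ltr0_norm ?subr_lt0// => ?.
    by rewrite ifT; [ring|lra].
  rewrite ger0_norm ?subr_ge0// => ?.
  by rewrite ifF; [ring|apply/negbTE; rewrite -leNgt; lra].
have [r0 r1] := andP rho01.
have geom k x : K x ->
    `|ps (N0 + k)%N x - psibar p x1 x2 tbar x| <= rho ^+ k * 1.
  move=> Kx; elim: k => [|k IH].
    have [Ox _] := KOm _ Kx.
    have : 0 <= ps N0 x <= 1 by exact: psi01.
    rewrite addn0 expr0 mul1r /psibar ler_norml; case: ifP => _ /andP[? ?]; apply/andP; split; lra.
  rewrite addnS step ?leq_addr// normrM gtr0_norm// exprS -mulrA ler_wpM2l//.
  exact: ltW.
have [N1 HN1] := geometric_small rho01 ler01 eps0.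
exists (N0 + N1)%N => j jN x Kx.
have N0j := leq_trans (leq_addr N1 N0) jN.
rewrite -/ps -(subnKC N0j) (le_lt_trans (geom _ _ Kx))// HN1//.
by rewrite leq_subRL.
Qed.
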